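(* Let $\mathbb Y$ be a normed space, let $f:\mathbb R^n\to\mathbb Y$ be a mapping and let $\bar x\in\mathbb R^n$. If $$\mathbf 0^*\in\bigcup_{y^*\in\mathbb S^*}\mathrm{int}\,\widehat\partial(y^*\circ f)(\bar x),$$ then $f$ is strongly metrically subregular at $\bar x$.
   Context: $\mathbb S^*$ is the unit sphere of the dual space $\mathbb Y^*$, $\mathbf 0^*$ is the null vector of $(\mathbb R^n)^*$, $\mathrm{int}$ denotes interior in $(\mathbb R^n)^*$, and $(y^*\circ f)(x)=\langle y^*,f(x)\rangle$. The Fréchet subdifferential of a function $\varphi$ at $\bar x$ is $$\widehat\partial\varphi(\bar x)=\left\{x^*:\ \liminf_{x\to\bar x}\frac{\varphi(x)-\varphi(\bar x)-\langle x^*,x-\bar x\rangle}{\|x-\bar x\|}\ge0\right\}.$$ A mapping $f:\mathbb R^n\to\mathbb Y$ is strongly metrically subregular at $\bar x$ if there exist $\kappa\ge0$ and $r>0$ such that $\|x-\bar x\|\le\kappa\|f(x)-f(\bar x)\|$ for all $x$ with $\|x-\bar x\|\le r$. *)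

(* Defs.v *)
From HB Require Import structures.
From mathcomp Require Import all_boot all_order all_algebra.
From mathcomp Require Import all_classical all_reals all_analysis.
From mathcomp Require Import ring.

Set Implicit Arguments.
Unset Strict Implicit.
Unset Printing Implicit Defensive.

Import Order.TTheory GRing.Theory Num.Theory.
Import numFieldTopology.Exports numFieldNormedType.Exports.

Local Open Scope classical_set_scope.
Local Open Scope ring_scope.

(* The library norm on ['rV[R]_n] is the sup norm, so the Euclidean space is an
   alias that inherits only the module structure of ['rV[R]_n]; its norm, and
   the topology induced by it, are installed below. *)
Definition euclidean (R : realType) (n : nat) : Type := 'rV[R]_n.

HB.instance Definition _ (R : realType) (n : nat) :=
  GRing.Lmodule.copy (euclidean R n) 'rV[R]_n.

Section EuclideanNorm.
Variables (R : realType) (n : nat).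
Implicit Types x y : 'rV[R]_n.

Definition eucl_norm x : R := Num.sqrt (\sum_(i < n) x ord0 i ^+ 2).

Lemma sumsq_ge0 x : 0 <= \sum_(i < n) x ord0 i ^+ 2.
Proof. by apply: sumr_ge0 => i _; rewrite sqr_ge0. Qed.

Lemma sumsq_eq0 x : \sum_(i < n) x ord0 i ^+ 2 = 0 -> x = 0.
Proof.
move/eqP; rewrite psumr_eq0 => [/allP x0|i _]; last exact: sqr_ge0.
apply/rowP => i; rewrite mxE; apply/eqP.
by have := x0 i (mem_index_enum i); rewrite /= sqrf_eq0.
Qed.

Lemma eucl_cauchy_schwarz x y :
  (\sum_(i < n) x ord0 i * y ord0 i) ^+ 2 <=
  (\sum_(i < n) x ord0 i ^+ 2) * (\sum_(i < n) y ord0 i ^+ 2).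
Proof.
set c := \sum_(i < n) _ * _; set a := \sum_(i < n) _ ^+ 2.
set b := \sum_(i < n) _ ^+ 2.
have [b0|b_neq0] := eqVneq b 0.
  rewrite b0 mulr0 /c big1 ?expr0n // => i _.
  by rewrite (sumsq_eq0 b0) mxE mulr0.
have b_gt0 : 0 < b by rewrite lt_neqAle eq_sym b_neq0 sumsq_ge0.
suff : 0 <= b * (a * b - c ^+ 2) by rewrite pmulr_rge0 // subr_ge0.
have -> : b * (a * b - c ^+ 2) =
    \sum_(i < n) (b * x ord0 i - c * y ord0 i) ^+ 2.
  transitivity (b ^+ 2 * a - 2 * b * c * c + c ^+ 2 * b); first by ring.
  rewrite [RHS](eq_bigr (fun i => b ^+ 2 * x ord0 i ^+ 2 -
    2 * b * c * (x ord0 i * y ord0 i) + c ^+ 2 * y ord0 i ^+ 2)) => [|i _].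
    by rewrite big_split sumrB /= -!mulr_sumr.
  by ring.
by apply: sumr_ge0 => i _; rewrite sqr_ge0.
Qed.

Lemma eucl_normD x y : eucl_norm (x + y) <= eucl_norm x + eucl_norm y.
Proof.
have xy0 : 0 <= eucl_norm x + eucl_norm y by rewrite addr_ge0 ?sqrtr_ge0.
rewrite -(ler_pXn2r (ltn0Sn 1)) ?nnegrE ?sqrtr_ge0 //.
rewrite sqrrD !sqr_sqrtr ?sumsq_ge0 //.
have -> : \sum_(i < n) (x + y) ord0 i ^+ 2 = \sum_(i < n) x ord0 i ^+ 2 +
    (\sum_(i < n) x ord0 i * y ord0 i) *+ 2 + \sum_(i < n) y ord0 i ^+ 2.
  rewrite -sumrMnl -!big_split /=.
  by apply: eq_bigr => i _; rewrite mxE sqrrD.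
rewrite lerD2r lerD2l lerMn2r /= -sqrtrM ?sumsq_ge0 //.
apply: le_trans (ler_norm _) _; rewrite -sqrtr_sqr ler_wsqrtr //.
exact: eucl_cauchy_schwarz.
Qed.

Lemma eucl_normZ (l : R) x : eucl_norm (l *: x) = `|l| * eucl_norm x.
Proof.
rewrite /eucl_norm -sqrtr_sqr -sqrtrM ?sqr_ge0 // mulr_sumr.
by congr Num.sqrt; apply: eq_bigr => i _; rewrite mxE exprMn.
Qed.

Lemma eucl_norm0_eq0 x : eucl_norm x = 0 -> x = 0.
Proof.
move/eqP; rewrite sqrtr_eq0 => x0; apply: sumsq_eq0.
by apply/eqP; rewrite eq_le x0 sumsq_ge0.
Qed.

End EuclideanNorm.

HB.instance Definition _ (R : realType) (n : nat) :=
  Lmodule_isNormed.Build R (euclidean R n)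
    (@eucl_normD R n) (@eucl_normZ R n) (@eucl_norm0_eq0 R n).

Definition dual_pred (R : realType) (V : normedModType R) : {pred V -> R^o} :=
  fun phi => `[< linear phi /\ continuous phi >].
Arguments dual_pred {R} V.

Record dual (R : realType) (V : normedModType R) := Dual {
  dual_fun :> V -> R^o;
  _ : dual_fun \in dual_pred V }.

HB.instance Definition _ (R : realType) (V : normedModType R) :=
  [isSub for @dual_fun R V].
HB.instance Definition _ (R : realType) (V : normedModType R) :=
  [Choice of dual V by <:].

Lemma dual_pred_submod (R : realType) (V : normedModType R) :
  submod_closed (dual_pred V).
Proof.
split=> [|k phi psi /asboolP[lphi cphi] /asboolP[lpsi cpsi]]; apply/asboolP.
  split=> [a u v|]; last exact: cst_continuous.
  by rewrite [LHS]/= scaler0 addr0.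
split=> [a u v|x].
  rewrite !fctE lphi lpsi !scalerDr !scalerA [k * a]mulrC.
  by rewrite addrACA.
by apply: cvgD; [apply: cvgZr; exact: cphi|exact: cpsi].
Qed.

HB.instance Definition _ (R : realType) (V : normedModType R) :=
  GRing.isSubmodClosed.Build R (V -> R^o) (dual_pred V) (@dual_pred_submod R V).
HB.instance Definition _ (R : realType) (V : normedModType R) :=
  [SubChoice_isSubLmodule of dual V by <:].

Lemma dualP (R : realType) (V : normedModType R) (phi : dual V) :
  linear phi /\ continuous phi.
Proof. by case: phi => phi /= /asboolP. Qed.

HB.instance Definition _ (R : realType) (V : normedModType R) (phi : dual V) :=
  GRing.isLinear.Build R V R^o _ phi (dualP phi).1.

Section DualNorm.
Variables (R : realType) (V : normedModType R).
Implicit Types phi psi : dual V.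

Lemma dual_addE phi psi (x : V) : (phi + psi) x = phi x + psi x.
Proof. by []. Qed.

Lemma dual_scaleE (l : R) phi (x : V) : (l *: phi) x = l * phi x.
Proof. by []. Qed.

Definition dual_norm phi : R := sup [set `|phi x| | x in [set x | `|x| <= 1]].

Lemma dual_norm_ub phi (x : V) : `|x| <= 1 -> `|phi x| <= dual_norm phi.
Proof.
move=> x1; apply: ub_le_sup; last by exists x.
have /linear_bounded_continuous/linear_boundedP := (dualP phi).2.
move=> /pinfty_ex_gt0[M M0 phiM]; exists M => _ [y /= y1 <-].
by apply: le_trans (phiM y) _; rewrite ler_piMr // ltW.
Qed.

Lemma dual_norm_le phi (M : R) :
  (forall x : V, `|x| <= 1 -> `|phi x| <= M) -> dual_norm phi <= M.
Proof.
move=> phiM; apply: ge_sup => [|_ [x /= x1 <-]]; last exact: phiM.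
by exists `|phi 0|, 0 => //=; rewrite normr0.
Qed.

Lemma dual_norm_ge0 phi : 0 <= dual_norm phi.
Proof.
by apply: le_trans (@dual_norm_ub phi 0 _); rewrite ?normr0.
Qed.

Lemma dual_normD phi psi :
  dual_norm (phi + psi) <= dual_norm phi + dual_norm psi.
Proof.
apply: dual_norm_le => x x1; rewrite dual_addE.
by apply: le_trans (ler_normD _ _) _; rewrite lerD ?dual_norm_ub.
Qed.

Lemma dual_normZ (l : R) phi : dual_norm (l *: phi) = `|l| * dual_norm phi.
Proof.
have le_normZ k psi : dual_norm (k *: psi) <= `|k| * dual_norm psi.
  apply: dual_norm_le => x x1.
  by rewrite dual_scaleE normrM ler_wpM2l ?dual_norm_ub.
apply/eqP; rewrite eq_le le_normZ /=.
have [->|l0] := eqVneq l 0; first by rewrite normr0 mul0r dual_norm_ge0.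
rewrite -ler_pdivlMl ?normr_gt0 // -normfV.
by apply: le_trans (le_normZ _ _); rewrite scalerA mulVf ?scale1r.
Qed.

Lemma dual_norm0_eq0 phi : dual_norm phi = 0 -> phi = 0.
Proof.
move=> phi0; apply/val_inj/funext => x /=.
have [->|x0] := eqVneq x 0; first exact: linear0.
have := @dual_norm_ub phi (`|x|^-1 *: x).
rewrite normrZ normfV normr_id mulVf ?normr_eq0 // => /(_ (lexx _)).
rewrite phi0 normr_le0 linearZ /= scaler_eq0 invr_eq0 normr_eq0 (negPf x0).
by move=> /eqP.
Qed.

End DualNorm.

HB.instance Definition _ (R : realType) (V : normedModType R) :=
  Lmodule_isNormed.Build R (dual V)
    (@dual_normD R V) (@dual_normZ R V) (@dual_norm0_eq0 R V).

Definition dual_sphere (R : realType) (V : normedModType R) : set (dual V) :=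
  [set phi | `|phi| = 1].
Arguments dual_sphere {R} V.

(* [x^'] is the punctured neighbourhood filter, so the value at [x = xbar] of
   the quotient is irrelevant. *)
Definition frechet_subdiff (R : realType) (V : normedModType R) (phi : V -> R)
    (xbar : V) : set (dual V) :=
  [set xi : dual V | (0 <= limf_einf (fun x : V =>
    ((phi x - phi xbar - xi (x - xbar)) / `|x - xbar|)%:E) xbar^')%E].

Definition strongly_metrically_subregular (R : realType)
    (V W : normedModType R) (f : V -> W) (xbar : V) : Prop :=
  exists kappa r : R, [/\ 0 <= kappa, 0 < r &
    forall x : V, `|x - xbar| <= r ->
      `|x - xbar| <= kappa * `|f x - f xbar| ].

(* Main.v *)
From HB Require Import structures.
Require Import Defs.
From mathcomp Require Import all_boot all_order all_algebra.
From mathcomp Require Import all_classical all_reals all_analysis.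
From mathcomp Require Import ring lra.
Import Order.TTheory GRing.Theory Num.Theory.
Import numFieldTopology.Exports numFieldNormedType.Exports.
Local Open Scope classical_set_scope.
Local Open Scope ring_scope.

(** The hypothesis makes [xbar] a sharp local minimizer of [x |-> ystar (f x)]:
    every small dual vector [xi] is a Fréchet subgradient there, so
    [ystar (f x) - ystar (f xbar)] is at least [xi (x - xbar)], up to
    [o(`|x - xbar|)].  Maximizing the right-hand side over a small dual ball
    would give a lower bound proportional to [`|x - xbar|].  The subgradient
    inequality however holds on a neighbourhood that depends on [xi], so only
    finitely many [xi] can be used at once; this is where the finite dimension
    enters.  The multiples [s *: eucl_coord i] and [- s *: eucl_coord i] of the
    coordinate functionals are enough, because the Euclidean norm is at most the
    sum of the moduli of the coordinates ([eucl_norm_le_sum]).  The resulting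
    linear growth ([interior_subdiff_growth]) passes from [ystar \o f] to [f]
    since [ystar] is 1-Lipschitz. *)

Lemma dual_norm_apply {R : realType} {V : normedModType R} (phi : dual V)
    (v : V) : `|phi v| <= `|phi| * `|v|.
Proof.
have [->|v0] := eqVneq v 0; first by rewrite linear0 !normr0 mulr0.
have nv0 : 0 < `|v| by rewrite normr_gt0.
have := @dual_norm_ub R V phi (`|v|^-1 *: v).
rewrite normrZ normfV normr_id mulVf ?gt_eqF// => /(_ (lexx _)).
by rewrite linearZ /= normrM normfV normr_id mulrC ler_pdivrMr.
Qed.

(** The quotient in the definition is taken over the punctured neighbourhood;
    multiplying out the denominator gives an inequality that also holds at
    [xbar], so it can be stated on a full neighbourhood. *)
Lemma frechet_subdiff_near {R : realType} {V : normedModType R} {phi : V -> R}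
    {xbar : V} {xi : dual V} {e : R} :
  frechet_subdiff phi xbar xi -> 0 < e ->
  \forall x \near xbar,
    xi (x - xbar) - e * `|x - xbar| <= phi x - phi xbar.
Proof.
rewrite /frechet_subdiff /= limf_einfE => xi_sub e0.
have e_lt0 : ((- e)%:E < 0)%E by rewrite lte_fin oppr_lt0.
have /ereal_sup_gt[_ [A xbarA <-] inf_gt] := lt_le_trans e_lt0 xi_sub.
move: xbarA; rewrite /dnbhs /within /=; apply: filterS => x xA.
have [->|xxbar] := eqVneq x xbar.
  by rewrite !subrr linear0 normr0 mulr0 subrr.
have d0 : 0 < `|x - xbar| by rewrite normr_gt0 subr_eq0.
have : ((- e)%:E < ((phi x - phi xbar - xi (x - xbar)) / `|x - xbar|)%:E)%E.
  apply: lt_le_trans inf_gt _; apply: ereal_inf_lbound.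
  by exists x => //; exact: xA.
by rewrite lte_fin ltr_pdivlMr// => /ltW ?; lra.
Qed.

Section EuclideanCoordinates.
Variables (R : realType) (n : nat).
Implicit Types (h : euclidean R n) (i : 'I_n).

Let coord i h : R := (h : 'rV[R]_n) ord0 i.

Lemma eucl_norm_coord i h : `|coord i h| <= `|h|.
Proof.
rewrite -sqrtr_sqr; apply: ler_wsqrtr.
rewrite (bigD1 i) //= lerDl; apply: sumr_ge0 => j _; exact: sqr_ge0.
Qed.

Lemma eucl_coord_in_dual i : coord i \in dual_pred (euclidean R n).
Proof.
have lin : linear (coord i : euclidean R n -> R^o).
  by move=> a u v; rewrite /coord !mxE.
apply/asboolP; split => //.
pose L := GRing.isLinear.Build R (euclidean R n) R^o _ _ lin.
pose F : {linear euclidean R n -> R^o} := HB.pack (coord i : _ -> R^o) L.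
suff : continuous F by [].
apply/linear_bounded_continuous.
apply/linear_boundedP; near=> M => x.
apply: le_trans (eucl_norm_coord i x) _.
rewrite ler_peMl//; near: M; apply: nbhs_pinfty_ge; exact: num_real.
Unshelve. all: by end_near. Qed.

Definition eucl_coord i : dual (euclidean R n) := Dual (eucl_coord_in_dual i).

Lemma eucl_norm_le_sum h : `|h| <= \sum_(i < n) `|eucl_coord i h|.
Proof.
have unit_norm i : `|(delta_mx 0 i : 'rV[R]_n) : euclidean R n| = 1.
  rewrite [LHS]/(eucl_norm _) /eucl_norm (bigD1 i) //= big1 => [|j /negPf ji].
    by rewrite mxE !eqxx expr1n addr0 sqrtr1.
  by rewrite mxE ji andbF expr0n.
rewrite [X in `|X|](row_sum_delta (h : 'rV[R]_n)).
apply: le_trans (ler_norm_sum _ _ _) _.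
apply: ler_sum => i _.
rewrite (normrZ _ ((delta_mx 0 i : 'rV[R]_n) : euclidean R n)).
by rewrite unit_norm mulr1.
Qed.

Lemma dual_norm_eucl_coord i : `|eucl_coord i| <= 1.
Proof.
by apply: dual_norm_le => h h1; exact: le_trans (eucl_norm_coord i h) h1.
Qed.

End EuclideanCoordinates.

(** Fix [s] such that the functionals of norm at most [s] are subgradients, and
    let [h := x - xbar].  The two signs of [s *: eucl_coord i] bound the
    increment of [phi] below by [s * `|h_i| - e * `|h|], for each [i].  Summing
    over [i], the first terms add up to at least [s * `|h|], and the errors are
    a fixed fraction of it once [e] is small compared to [s / n]. *)
Lemma interior_subdiff_growth {R : realType} {n : nat}
    {phi : euclidean R n -> R} {xbar : euclidean R n} :
  (frechet_subdiff phi xbar)° 0 ->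
  exists2 c : R, 0 < c &
    \forall x \near xbar, c * `|x - xbar| <= phi x - phi xbar.
Proof.
rewrite /interior /= => /nbhs_normP[d /= d0 ball_sub].
have s0 : 0 < d / 2 by rewrite divr_gt0.
set s := d / 2 in s0.
have small (t : R) i : `|t| <= s ->
    frechet_subdiff phi xbar (t *: eucl_coord R n i).
  move=> ts; apply: ball_sub; rewrite /ball_ /= sub0r normrN.
  rewrite normrZ (@le_lt_trans _ _ s) //; last by rewrite /s; lra.
  by apply: le_trans ts; rewrite ler_piMr ?dual_norm_eucl_coord.
have zero_sub : frechet_subdiff phi xbar 0.
  by apply: ball_sub; rewrite /ball_ /= subrr normr0.
have n0 : 0 < n.+1%:R :> R by rewrite ltr0n.
(* With this [e], the [n.+1] error terms below use up half of [s * `|h|]; the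
   other half, shared among the [n.+1] inequalities, leaves [e] as growth
   constant. *)
pose e := s / 2 / n.+1%:R.
have e0 : 0 < e by rewrite !divr_gt0.
exists e => //.
have coords : \forall x \near xbar, forall i : 'I_n,
    s * `|eucl_coord R n i (x - xbar)| - e * `|x - xbar| <= phi x - phi xbar.
  apply: (@filter_forall _ _ _ (nbhs xbar)) => i.
  have ns : `|s| <= s by rewrite gtr0_norm.
  have nns : `|- s| <= s by rewrite normrN.
  have := frechet_subdiff_near (small _ i ns) e0.
  have := frechet_subdiff_near (small _ i nns) e0.
  apply: filterS2 => x; rewrite !dual_scaleE => lo hi.
  have [p|p] := ger0P (eucl_coord R n i (x - xbar)); first exact: hi.
  by rewrite mulrN -mulNr.
(* The null subgradient contributes one inequality besides those of the [n]
   coordinates, so that the average below also makes sense when [n = 0]. *)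
have := frechet_subdiff_near zero_sub e0.
move: coords; apply: filterS2 => x ge_coord.
rewrite [dual_fun 0 _](_ : _ = 0) // sub0r => ge_null.
have := eucl_norm_le_sum _ _ (x - xbar).
move: (phi x - phi xbar) `|x - xbar| ge_null ge_coord => D N ge_null ge_coord.
rewrite -(ler_pM2l s0) mulr_sumr => le_sum.
rewrite -(ler_pM2l n0).
have := ler_sum (index_enum 'I_n) (P := xpredT) (fun i _ => ge_coord i).
rewrite sumrB !sumr_const card_ord -(mulr_natl _ n) -(mulr_natl D).
move: (\sum_i _) le_sum => S le_sum sum_ge.
have nE : n.+1%:R = n%:R + 1 :> R by rewrite -natr1.
have eE : n%:R * (e * N) + e * N = s / 2 * N.
  by rewrite -[in RHS](mulfVK (lt0r_neq0 n0) (s / 2)) -/e nE; ring.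
by move: ge_null; rewrite nE; lra.
Qed.

Theorem theorem7 (R : realType) (n : nat) (Y : normedModType R)
    (f : euclidean R n -> Y) (xbar : euclidean R n) :
  (\bigcup_(ystar in dual_sphere Y)
     (frechet_subdiff (fun x => ystar (f x)) xbar)°) 0 ->
  strongly_metrically_subregular f xbar.
Proof.
case=> ystar ystar1 /interior_subdiff_growth[c c0] /nbhs_normP[d /= d0 growth].
exists c^-1, (d / 2); split; [by rewrite invr_ge0 ltW | by rewrite divr_gt0 |].
move=> x xd; rewrite ler_pdivlMl //.
have /growth /le_trans : ball_ (fun v => `|v|) xbar d x.
  by rewrite /ball_ /= distrC; lra.
apply; rewrite -linearB; apply: le_trans (ler_norm _) _.
apply: le_trans (dual_norm_apply ystar _) _.
by rewrite [`|ystar|]ystar1 mul1r.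
Qed.
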